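(* Let $n\ge 2$ and let $\Lambda = \{0, \lambda_2, \ldots, \lambda_n\}$ be a multiset of real numbers with $0 < \lambda_2 \leq \cdots \leq \lambda_n$. For $0\le k\le n-1$ let $\sigma_k$ be the $k$-th elementary symmetric function of the numbers $\lambda_2, \ldots, \lambda_n$ (with $\sigma_0=1$), and let $$f(x) = \frac{\sigma_0}{1}x^{n-1} + \frac{\sigma_1}{2}x^{n-2} + \frac{\sigma_2}{3}x^{n-3} + \cdots + \frac{\sigma_{n-1}}{n}.$$ Then $\Lambda$ is Laplacian realizable for the star $K_{1,n-1}$ if and only if $(-1)^k f(-\lambda_k) \leq 0$ for all $k = 2, \ldots, n-1$.
   Context: Graphs are finite and simple. For a graph $G$ on $n$ vertices, $\mathcal{S}_L(G)$ denotes the set of $n\times n$ real symmetric matrices $A=[a_{i,j}]$ such that $a_{i,j}<0$ if $\{i,j\}\in E(G)$, $a_{i,j}=0$ if $i\neq j$ and $\{i,j\}\notin E(G)$, and $a_{i,i}=-\sum_{k\neq i}a_{i,k}$ for all $i$. A multiset $\{0,\lambda_2,\ldots,\lambda_n\}$ of real numbers is Laplacian realizable for $G$ if there is $A\in\mathcal{S}_L(G)$ whose spectrum (multiset of eigenvalues) is $\{0,\lambda_2,\ldots,\lambda_n\}$. $K_{1,n-1}$ is the star on $n$ vertices (one central vertex adjacent to $n-1$ leaves). *)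

(* Defs.v *)
From HB Require Import structures.
From mathcomp Require Import all_boot all_order all_algebra.
From mathcomp Require Import reals.
From mathcomp Require mpoly.

Set Implicit Arguments.
Unset Strict Implicit.
Unset Printing Implicit Defensive.

Import Order.TTheory GRing.Theory Num.Theory.

Local Open Scope ring_scope.

Record sgraph (n : nat) := SGraph {
  edge : rel 'I_n;
  edge_sym : symmetric edge;
  edge_irrefl : irreflexive edge }.

(* Vertex 0 is the centre. *)
Definition star_edge (n : nat) : rel 'I_n := fun i j =>
  ((i == 0%N :> nat) && (j != 0%N :> nat)) || ((i != 0%N :> nat) && (j == 0%N :> nat)).

Lemma star_edge_sym (n : nat) : symmetric (@star_edge n).
Proof. by move=> i j; rewrite /star_edge orbC andbC [in X in _ || X]andbC. Qed.

Lemma star_edge_irrefl (n : nat) : irreflexive (@star_edge n).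
Proof. by move=> i; rewrite /star_edge andbN andNb. Qed.

Definition star (n : nat) : sgraph n :=
  SGraph (@star_edge_sym n) (@star_edge_irrefl n).

(* The set S_L(G) of weighted Laplacian matrices of G. *)
Definition SL (R : realType) (n : nat) (G : sgraph n) (A : 'M[R]_n) : Prop :=
  [/\ A^T = A,
      forall i j, edge G i j -> A i j < 0,
      forall i j, i != j -> ~~ edge G i j -> A i j = 0
    & forall i, A i i = - \sum_(k < n | k != i) A i k].

(* The eigenvalues of A, counted with multiplicity, are the entries of s; the
   order of s is irrelevant, so that s stands for a multiset. *)
Definition has_spectrum (R : realType) (n : nat) (A : 'M[R]_n) (s : seq R) :
    Prop :=
  char_poly A = \prod_(x <- s) ('X - x%:P).

Definition laplacian_realizable (R : realType) (n : nat) (G : sgraph n)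
    (s : seq R) : Prop :=
  exists A : 'M[R]_n, SL G A /\ has_spectrum A s.

(* A list lambda_2, ..., lambda_n is the restriction to 2 <= i <= n of a
   function lam : nat -> R; the ordinal i < n.-1 stands for the index i + 2. *)
Definition sigma (R : realType) (n : nat) (lam : nat -> R) (k : nat) : R :=
  mpoly.meval (fun i : 'I_n.-1 => lam (i + 2)%N) (mpoly.mesym n.-1 R k).

Definition fpoly (R : realType) (n : nat) (lam : nat -> R) : {poly R} :=
  \sum_(k < n) (sigma n lam k / k.+1%:R) *: 'X^(n.-1 - k).

(* Main.v *)
Require Import Defs.
From HB Require Import structures.
From mathcomp Require Import all_boot all_order all_algebra.
From mathcomp Require Import boolp reals.
From mathcomp Require Import polyrcf.
From mathcomp Require mpoly.
From mathcomp Require Import zify ring.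

Set Implicit Arguments.
Unset Strict Implicit.
Unset Printing Implicit Defensive.

Import Order.TTheory GRing.Theory Num.Theory.

Local Open Scope ring_scope.

(** Write the weights of the star as w_1, ..., w_m with m = n - 1, put
    q = (X - w_1) ... (X - w_m) and g = (X - lam_2) ... (X - lam_n).  A Schur
    complement computation on the arrow-shaped matrix gives
      char_poly A = X * (n q - X q'),
    so [char_poly_star] turns realizability into: g = n q - X q' for some q
    with m positive roots.  The operator q |-> n q - X q' multiplies the
    coefficient of X^j by n - j, hence it is invertible on degrees below n, and
    the only candidate for q is [star_inv n g], whose value at x is
    (-1)^m f(-x) ([fpoly_star_inv]).  It remains to see when this q has m
    positive roots, in terms of its signs at the lam_k.

    If q has m positive roots, consider P(t) = t^n q(1/t).  Its derivative is
    t^(n-1) g(1/t), and P vanishes at 0 and at the 1/w_i; Rolle's theorem thus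
    puts a root of g between any two distinct w_i and a further one above all of
    them ([star_op_rolle]), while a root of multiplicity s of q is a root of
    multiplicity s - 1 of g ([mup_star_op]).  Counting roots of g above and
    below lam_k, of which there are only m in all, forces exactly n - k of the
    w_i to lie above lam_k, unless lam_k is itself one of them; this determines
    the sign of q(lam_k) ([interlacing_signs]).

    Conversely, the coefficients of g alternate in sign, so do those of q, and
    every real root of q is positive.  Split q as the product of X - w over its
    real roots w and of a factor h without real roots, which is positive
    everywhere.  The sign of q at lam_k then gives the parity of the number of
    real roots above lam_k when lam_k is not a root, and otherwise lam_k is a
    root of q of larger multiplicity than of g, again by [mup_star_op].  Going
    down from lam_(n-1) to lam_2 and then to 0, these parities and
    multiplicities force m real roots ([size_le_count_of_parity]), so that
    h = 1. *)

(** * Counting in sorted lists *)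

(** The entries are added from the largest down to x.  If a new entry y is not
    in [ws], there are by induction at least as many elements of [ws] as entries
    above y, and the parity condition supplies one more; an entry in [ws] is
    paid for by its own multiplicity.  Counting strictly above x, and adding the
    multiplicity of x only when x is in [ws], is what makes the induction go
    through repeated entries. *)
Lemma size_le_count_of_parity d (T : orderType d) (ws s : seq T) (x : T) :
    path <=%O x s ->
    (forall i, (i <= size s)%N -> nth x (x :: s) i \notin ws ->
       odd (count (> nth x (x :: s) i)%O ws) = odd (size s - i).+1) ->
    (forall y, y \in ws -> (count_mem y (x :: s) <= count_mem y ws)%N) ->
  (size (x :: s) <=
     count (> x)%O ws + (if x \in ws then count_mem x (x :: s) else 0))%N.
Proof.
elim: s x => [|y s IHs] x /= xs par mult.
  case: ifP => [xws|/negbT xws]; first by rewrite eqxx leq_addl.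
  by rewrite addn0; apply: odd_gt0; rewrite (par 0%N isT xws).
have {xs} [lexy ys] := andP xs.
have {}IHs : (size (y :: s) <= count (> y)%O ws +
    (if y \in ws then count_mem y (y :: s) else 0))%N.
  apply: IHs => // [i lei|z zws]; last first.
    by apply: leq_trans (mult z zws); rewrite /= leq_addl.
  have := par i.+1 lei.
  by rewrite /= !(set_nth_default x y).
have par0 : x \notin ws -> odd (count (> x)%O ws) = odd (size s).+2.
  exact: par 0%N isT.
move: lexy; rewrite le_eqVlt => /predU1P[eqxy|ltxy].
  (* The parities prescribed at the two copies of x are contradictory, so x
     has to be in ws. *)
  subst y; have xws : x \in ws.
    apply: contraT => xws; have := par 1%N isT xws.
    by rewrite /= subn1 par0 //=; case: odd.
  by move: IHs; rewrite xws /= eqxx; lia.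
have {}IHs : (size (y :: s) <= count (> x)%O ws)%N.
  have -> : count (> x)%O ws =
      (count (predU (> y)%O (pred1 y)) ws + count (fun z => x < z < y)%O ws)%N.
    elim: (ws) => //= w r ->; case: (ltgtP y w) => [ltyw|ltwy|<-] /=.
    - by rewrite (lt_trans ltxy ltyw) andbF /=; lia.
    - by rewrite andbT; lia.
    - by rewrite ltxy andbF; lia.
  have -> : count (predU (> y)%O (pred1 y)) ws =
      (count (> y)%O ws + count_mem y ws)%N.
    rewrite -(count_predUI (> y)%O (pred1 y)).
    rewrite (@eq_count _ (predI _ _) pred0) ?count_pred0 ?addn0 // => z /=.
    by case: ltgtP => // ->; rewrite ltxx.
  apply: leq_trans IHs _; case: ifP => [yws|_]; last by lia.
  have := mult y yws; rewrite /= eqxx; lia.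
case: ifP => [_|/negbT/par0 {}par0]; first by
  rewrite /= eqxx; move: IHs => /=; lia.
move: IHs; rewrite /= leq_eqVlt => /predU1P[eqs|]; last by lia.
by move: par0; rewrite -eqs /=; case: odd.
Qed.

(** Interlacing in multiplicity form: if [ls] separates the distinct values of
    [ws] and loses at most one from each multiplicity, it has at most one
    element fewer than [ws], and none fewer when it also goes beyond the
    largest value of [ws] (the case [b = true]).  The hypotheses pass to the
    parts of [ws] and [ls] below or above a given point, which is how the
    statement is used. *)
Lemma size_le_of_separated d (T : orderType d) (ws ls : seq T) (b : bool) :
    (forall x y, x \in ws -> y \in ws -> x < y ->
       exists2 z, z \in ls & x < z < y)%O ->
    (forall x, x \in ws -> (count_mem x ws <= (count_mem x ls).+1)%N) ->
    (b -> forall x, x \in ws -> exists2 z, z \in ls & x < z)%O ->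
  (size ws + b <= (size ls).+1)%N.
Proof.
have : perm_eq (sort <=%O ws) ws by rewrite perm_sort.
have : sorted <=%O (sort <=%O ws) by exact: sort_le_sorted.
case: (sort _ _) => [_ /perm_size/esym/size0nil->|x s xs pws sep mult above].
  by rewrite add0n (leq_trans (leq_b1 b)).
have memws := perm_mem pws.
have {}sep y z : y \in x :: s -> z \in x :: s -> (y < z)%O ->
    has (fun u => y < u < z)%O ls.
  rewrite !memws => yws zws ltyz.
  by apply/hasP; have [u] := sep y z yws zws ltyz; exists u.
have {}above : b -> forall y, y \in x :: s -> has (> y)%O ls.
  move=> hb y; rewrite memws => yws.
  by apply/hasP; have [u] := above hb y yws; exists u.
have {}mult : (count_mem x (x :: s) <= (count_mem x ls).+1)%N /\
    forall y, y \in x :: s -> (count_mem y (x :: s) <= (count_mem y ls).+1)%N.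
  split=> [|y yws]; rewrite (permP pws); apply: mult; rewrite -memws //.
  by rewrite mem_head.
have {mult} [mult0 mult] := mult.
have cntD (p1 p2 p : pred T) : (forall z, p1 z + p2 z <= p z)%N ->
    (count p1 ls + count p2 ls <= count p ls)%N.
  by move=> p12; elim: ls {sep above mult0 mult} => //= z r IHr;
    have := p12 z; lia.
(* With the copies of x in ls traded for those in ws, the bound holds for every
   tail of the sorted ws, and can be proved by induction. *)
suff main : (size (x :: s) + b <= count (> x)%O ls + count_mem x (x :: s))%N.
  rewrite -(perm_size pws); apply: (leq_trans main).
  apply: leq_trans (_ : count (> x)%O ls + (count_mem x ls).+1 <= _)%N.
    by lia.
  rewrite addnS ltnS -count_predT; apply: cntD => z /=.
  by case: ltgtP.
elim: s x xs sep above mult {mult0 pws memws} => [|y s IHs] x xs sep above mult.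
  rewrite /= eqxx; case: b above => [above|_]; last by lia.
  have := above isT x (mem_head _ _); by rewrite has_count addn0 leq_add2r.
have /andP[lexy ys] := xs.
have sub z : z \in y :: s -> z \in [:: x, y & s].
  by move=> zs; rewrite inE zs orbT.
have {}IHs : (size (y :: s) + b <= count (> y)%O ls + count_mem y (y :: s))%N.
  apply: IHs => // [u v /sub us /sub vs|hb u /sub us|u us].
  - exact: sep.
  - exact: above hb _ us.
  - by apply: leq_trans (mult _ (sub u us)); rewrite /= leq_addl.
move: lexy; rewrite le_eqVlt => /predU1P[eqxy|ltxy].
  by subst y; move: IHs; rewrite /= eqxx; lia.
have := mult y (sub y (mem_head _ _)); rewrite /= eqxx (lt_eqF ltxy) add0n.
have: (0 < count (fun u => x < u < y)%O ls)%N.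
  by rewrite -has_count sep ?mem_head // inE mem_head orbT.
have: (count (fun u => x < u < y)%O ls + count (>= y)%O ls <=
   count (> x)%O ls)%N.
  apply: cntD => z /=; case: (ltgtP y z) => [lt|lt|<-]; rewrite ?andbF ?ltxy //.
    by rewrite (lt_trans ltxy lt).
  by rewrite andbT addn0.
have: (count (> y)%O ls + count_mem y ls <= count (>= y)%O ls)%N.
  by apply: cntD => z /=; case: ltgtP.
move: IHs; rewrite /= !eqxx; lia.
Qed.

(** * The operator relating weights to eigenvalues *)

Section StarOperator.
Variable R : realType.
Implicit Types (p q g : {poly R}) (n m : nat) (x y w : R) (ws : seq R).

Definition star_op n q : {poly R} := q *+ n - 'X * q^`().

Definition star_inv n g : {poly R} := \poly_(j < n) (g`_j / (n - j)%:R).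

Lemma coef_star_op n q j : (star_op n q)`_j = q`_j * (n%:R - j%:R).
Proof.
rewrite coefB coefMn coefXM coef_deriv mulrBr !mulr_natr.
by case: j => [|j] //=; rewrite mulr0n.
Qed.

Lemma star_op_inv n g : (size g <= n)%N -> star_op n (star_inv n g) = g.
Proof.
move=> sg; apply/polyP => j; rewrite coef_star_op coef_poly.
case: ltnP => [ltjn|lenj]; last first.
  by rewrite mul0r nth_default // (leq_trans sg).
by rewrite -natrB 1?ltnW // divfK // pnatr_eq0 subn_eq0 -ltnNge.
Qed.

Lemma star_inv_op n q : (size q <= n)%N -> star_inv n (star_op n q) = q.
Proof.
move=> sq; apply/polyP => j; rewrite coef_poly coef_star_op.
case: ltnP => [ltjn|lenj]; last by rewrite nth_default // (leq_trans sq).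
by rewrite -natrB 1?ltnW // mulfK // pnatr_eq0 subn_eq0 -ltnNge.
Qed.

(** Rolle's theorem for P(t) = t^n q(1/t), whose derivative is
    t^(n-1) (n q - X q')(1/t): the roots x < y of q give the roots 1/y < 1/x
    of P.  As P(0) = 0, the point 0 may stand for 1/y, and then the root found
    is merely above x.  Since 0^-1 = 0, this case of y at infinity is encoded
    by y = 0. *)
Lemma star_op_rolle n q x y : (size q <= n)%N -> 0 < x ->
    root q x -> (y = 0 \/ x < y /\ root q y) ->
  exists2 z, root (star_op n q) z & x < z /\ (y = 0 \/ z < y).
Proof.
move=> sq x0 qx qy.
pose P : {poly R} := \sum_(j < n) q`_j *: 'X^(n - j).
have PE (t : R) : t != 0 -> P.[t^-1] = q.[t] / t ^+ n.
  move=> t0; rewrite horner_sum (horner_coef_wide _ sq) mulr_suml.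
  apply: eq_bigr => j _; rewrite !hornerE exprVn -mulrA; congr (_ * _).
  have tn0 : t ^+ (n - j) != 0 by rewrite expf_neq0.
  have -> : t ^+ n = t ^+ (n - j) * t ^+ j.
    by rewrite -exprD subnK // ltnW.
  by rewrite invfM mulrCA divff ?mulr1 ?expf_neq0.
have PdE (t : R) : t != 0 -> t ^+ n.-1 * P^`().[t^-1] = (star_op n q).[t].
  move=> t0.
  have sg : (size (star_op n q) <= n)%N.
    apply/leq_sizeP => j lenj; rewrite coef_star_op nth_default ?mul0r //.
    exact: leq_trans sq lenj.
  rewrite raddf_sum /= horner_sum (horner_coef_wide _ sg) mulr_sumr.
  apply: eq_bigr => j _.
  rewrite derivZ derivXn !hornerE hornerMn !hornerE coef_star_op exprVn.
  rewrite -natrB 1?ltnW // -mulr_natr.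
  have -> : n.-1 = (j + (n - j).-1)%N by have := ltn_ord j; lia.
  rewrite exprD.
  have tn0 : t ^+ (n - j).-1 != 0 by rewrite expf_neq0.
  move: tn0; rewrite /=; move: (t ^+ _) (t ^+ _) (q`_j) (_%:R) => u v a c v0.
  by field.
have Py : P.[y^-1] = 0.
  case: qy => [->|[ltxy /rootP qy]]; last first.
    by rewrite PE ?qy ?mul0r // gt_eqF // (lt_trans x0).
  rewrite invr0 horner_sum big1 // => j _.
  by rewrite !hornerE expr0n subn_eq0 leqNgt ltn_ord mulr0.
have Px : P.[x^-1] = 0 by rewrite PE ?(rootP qx) ?mul0r // gt_eqF.
have ltyx : y^-1 < x^-1.
  case: qy => [->|[ltxy _]]; first by rewrite invr0 invr_gt0.
  by rewrite ltf_pV2 // posrE (lt_trans x0).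
have [|c] := poly_rolle ltyx (p := P); first by rewrite Px Py.
rewrite in_itv /= => /andP[ltyc ltcx] Pc.
have y0 : 0 <= y^-1.
  by case: qy => [->|[ltxy _]]; rewrite ?invr0 // invr_ge0 ltW // (lt_trans x0).
have c0 : 0 < c by rewrite (le_lt_trans y0).
exists c^-1.
  by apply/rootP; rewrite -PdE ?invr_neq0 ?gt_eqF // invrK Pc mulr0.
split; first by rewrite -[x]invrK ltf_pV2 // posrE invr_gt0.
case: qy => [|[ltxy _]]; [by left|right].
by rewrite -[y]invrK ltf_pV2 // posrE invr_gt0 (lt_trans x0).
Qed.

(** Differentiation lowers the multiplicity of a root by exactly one, and
    neither multiplying by X nor adding a multiple of q interferes when the
    root is nonzero. *)
Lemma mup_star_op n q x : q != 0 -> x != 0 -> root q x ->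
  mup x q = (mup x (star_op n q)).+1.
Proof.
move=> q0 x0 qx.
have [[|r] [h]] := multiplicity_XsubC q x; rewrite q0 /= => hx qE.
  by move: qx; rewrite qE mulr1 (negPf hx).
rewrite qE mupMr // mup_XsubCX eqxx; congr _.+1; symmetry.
have -> : star_op n (h * ('X - x%:P) ^+ r.+1) =
    (('X - x%:P) * (h *+ n - 'X * h^`()) - 'X * h *+ r.+1) * ('X - x%:P) ^+ r.
  rewrite /star_op derivM deriv_exp derivXsubC mul1r /= exprS.
  by ring.
rewrite mupMr ?mup_XsubCX ?eqxx // rootE hornerD hornerN !hornerM hornerXsubC.
rewrite subrr mul0r sub0r oppr_eq0 hornerMn hornerM hornerX -mulr_natr.
by rewrite !mulf_neq0 ?pnatr_eq0.
Qed.

End StarOperator.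

(** * The characteristic polynomial of a weighted star *)

Lemma deriv_prod (K : comNzRingType) (I : finType) (F : I -> {poly K}) :
  (\prod_i F i)^`() = \sum_i (F i)^`() * \prod_(j | j != i) F j.
Proof.
elim: (index_enum I) (index_enum_uniq I) => [_|x s IHs /= /andP[xs us]].
  by rewrite !big_nil derivC.
rewrite !big_cons derivM eqxx IHs //; congr (_ * _ + _).
  rewrite big_seq [RHS]big_seq_cond; apply: eq_bigl => j.
  by case: eqVneq => [->|]; rewrite ?(negPf xs) ?andbT.
rewrite mulr_sumr big_seq [RHS]big_seq; apply: eq_bigr => i si.
rewrite big_cons; case: eqVneq => [xi|_]; last by rewrite mulrCA.
by rewrite xi si in xs.
Qed.

(** Division-free Schur complement: multiplying on the right by a matrix of
    determinant delta = \prod_i d_i clears the first column below the corner,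
    and delta is then cancelled from both sides. *)
Lemma det_arrow (K : idomainType) m (a : K) (b : 'rV[K]_m) (c : 'cV[K]_m)
    (d : 'rV[K]_m) : (forall i, d 0 i != 0) ->
  \det (block_mx a%:M b c (diag_mx d)) =
    a * \prod_i d 0 i - \sum_i b 0 i * c i 0 * \prod_(j | j != i) d 0 j.
Proof.
move=> d0; pose e i := \prod_(j | j != i) d 0 j; pose delta := \prod_i d 0 i.
have deltaE i : delta = d 0 i * e i by rewrite /delta (bigD1 i).
have delta0 : delta != 0 by apply/prodf_neq0.
pose N := block_mx delta%:M 0 (- \col_i (e i * c i 0)) 1%:M : 'M[K]_(1 + m).
have detN : \det N = delta by rewrite det_lblock det1 mulr1 det_scalar1.
have MN : block_mx a%:M b c (diag_mx d) *m N =
    block_mx (a * delta - \sum_i b 0 i * c i 0 * e i)%:M b 0 (diag_mx d).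
  rewrite mulmx_block !mulmx0 !mulmx1 !add0r; congr block_mx.
    rewrite -scalar_mxM mulmxN; apply/matrixP => i j.
    rewrite !ord1 !mxE /= mulr1n; congr (_ - _).
    by apply: eq_bigr => k _; rewrite mxE mulrAC mulrA.
  apply/matrixP => i j; rewrite mulmxN mul_diag_mx mul_mx_scalar !ord1 !mxE.
  by rewrite mulrA -deltaE subrr.
apply: (mulIf delta0); rewrite -{1}detN -det_mulmx MN det_ublock det_diag.
by rewrite det_scalar1.
Qed.

Section StarLaplacian.
Variables (R : realType) (m : nat).
Implicit Types A : 'M[R]_m.+1.

Definition star_weights A : seq R := [seq - A ord0 (lift ord0 i) | i : 'I_m].

Lemma star_weights_gt0 A w : SL (star m.+1) A -> w \in star_weights A -> 0 < w.
Proof. by case=> _ neg _ _ /mapP[i _ ->]; rewrite oppr_gt0 neg. Qed.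

(** With pi_i the product of the X - w_j over j != i, the arrow determinant is
    (X - \sum_i w_i) q - \sum_i w_i^2 pi_i.  What then
    remains besides X q on either side of the identity is a sum over i, and the
    two sums agree term by term because q = (X - w_i) pi_i and
    q' = \sum_i pi_i. *)
Lemma char_poly_star A : SL (star m.+1) A ->
  char_poly A =
    'X * star_op m.+1 (\prod_(w <- star_weights A) ('X - w%:P)).
Proof.
case=> symA _ offA diagA; pose w i := - A ord0 (lift ord0 i).
have Aw i : A ord0 (lift ord0 i) = - w i by rewrite opprK.
have Aw' i : A (lift ord0 i) ord0 = - w i by rewrite -Aw -[in LHS]symA mxE.
have A00 : A ord0 ord0 = \sum_i w i.
  rewrite diagA big_mkcond big_ord_recl eqxx /= add0r -sumrN.
  by apply: eq_bigr => i _.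
have offw i j : i != j -> A (lift ord0 i) (lift ord0 j) = 0.
  by move=> neij; apply: offA; rewrite ?(inj_eq (@lift_inj _ _)).
have Aii i : A (lift ord0 i) (lift ord0 i) = w i.
  rewrite diagA big_mkcond big_ord_recl eq_liftF /= big1 => [|j _].
    by rewrite addr0 Aw' opprK.
  by case: ifP => // neji; rewrite offw // -(inj_eq (@lift_inj _ ord0)) eq_sym.
pose d := \row_i ('X - (w i)%:P) : 'rV[{poly R}]_m.
pose p := \prod_i ('X - (w i)%:P).
pose pi i := \prod_(j | j != i) ('X - (w j)%:P).
have pE i : p = ('X - (w i)%:P) * pi i by rewrite /p (bigD1 i).
have -> : \prod_(w <- star_weights A) ('X - w%:P) = p.
  by rewrite big_map big_enum.
have dp : p^`() = \sum_i pi i.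
  rewrite deriv_prod; apply: eq_bigr => i _.
  by rewrite derivXsubC mul1r.
have detE : char_poly A =
    ('X - (\sum_i w i)%:P) * p - \sum_i (w i ^+ 2)%:P * pi i.
  rewrite /char_poly.
  have -> : char_poly_mx A = block_mx ('X - (\sum_i w i)%:P)%:M
      (\row_i (w i)%:P) (\col_i (w i)%:P) (diag_mx d) :> 'M_(1 + m).
    rewrite -[LHS](@submxK _ 1 m 1 m); congr block_mx;
      apply/matrixP => i j; rewrite !mxE.
    - by rewrite !ord1 lshift0 A00 eqxx !mulr1n.
    - by rewrite ord1 lshift0 rshift1 Aw polyCN opprK add0r.
    - by rewrite [j]ord1 lshift0 rshift1 Aw' polyCN opprK add0r.
    - rewrite !rshift1 (inj_eq (@lift_inj _ ord0)).
      by case: eqVneq => [->|neij]; rewrite ?Aii ?offw // polyC0 subr0.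
  rewrite det_arrow => [|i]; last by rewrite mxE polyXsubC_eq0.
  under eq_bigr do rewrite mxE.
  congr (_ - _); apply: eq_bigr => i _; rewrite !mxE -polyCM -expr2.
  by congr (_ * _); apply: eq_bigr => j _; rewrite mxE.
rewrite detE /star_op dp mulrSr mulrBl (rmorph_sum polyC) /= mulr_suml.
rewrite mulrBr mulrDr mulrnAr !mulr_sumr ['X * p *+ m + _]addrC.
rewrite -!addrA; congr (_ + _).
have -> : 'X * p *+ m = \sum_(i < m) 'X * p by rewrite sumr_const card_ord.
rewrite -opprD -big_split -sumrN -sumrB; apply: eq_bigr => i _.
by rewrite (pE i) rmorphXn /=; ring.
Qed.
End StarLaplacian.

Lemma star_matrix_exists (R : realType) m (ws : seq R) :
    size ws = m -> (forall w, w \in ws -> 0 < w) ->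
  exists2 A : 'M[R]_m.+1, SL (star m.+1) A & star_weights A = ws.
Proof.
move=> sws ws0; pose w i := ws`_i.
have w0 (i : 'I_m) : 0 < w i by rewrite ws0 // mem_nth // sws.
pose A : 'M[R]_m.+1 := \matrix_(i, j)
  match unlift ord0 i, unlift ord0 j with
  | None, None => \sum_(k < m) w k
  | None, Some k | Some k, None => - w k
  | Some k, Some l => if k == l then w k else 0
  end.
exists A; last first.
  apply: (@eq_from_nth _ 0) => [|i];
    rewrite size_map size_enum_ord ?sws // => im.
  rewrite (nth_map (Ordinal im)) ?size_enum_ord // mxE unlift_none liftK opprK.
  by rewrite nth_enum_ord.
split=> [|i j|i j|i].
- apply/matrixP => i j; rewrite !mxE.
  case: (unliftP ord0 i) => [k _|_]; case: (unliftP ord0 j) => [l _|_] //.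
  by rewrite eq_sym; case: eqVneq => // ->.
- rewrite mxE; case: (unliftP ord0 i) => [k|] ->;
    case: (unliftP ord0 j) => [l|] -> //= _; by rewrite oppr_lt0.
- rewrite mxE; case: (unliftP ord0 i) => [k|] ->;
    case: (unliftP ord0 j) => [l|] -> //=.
  by rewrite (inj_eq (@lift_inj _ ord0)) => /negPf->.
- rewrite big_mkcond big_ord_recl; case: (unliftP ord0 i) => [k|] ->; last first.
    rewrite eqxx /= add0r -sumrN mxE unlift_none; apply: eq_bigr => k _.
    by rewrite mxE unlift_none liftK opprK.
  rewrite /= mxE liftK eqxx big1 ?addr0; last first.
    move=> l _; rewrite !mxE !liftK (inj_eq (@lift_inj _ ord0)) eq_sym.
    by case: eqVneq.
  by rewrite mxE liftK unlift_none opprK.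
Qed.

(** * Signs of real polynomials *)

Section Signs.
Variable R : realType.
Implicit Types (p q g h : {poly R}) (x y l w : R) (ls ws : seq R).

Lemma split_real_roots p : p != 0 ->
  exists ws h, p = (\prod_(w <- ws) ('X - w%:P)) * h /\
               forall x, ~~ root h x.
Proof.
elim/ltn_ind: {p}(size p) {-2}p (erefl (size p)) => s IHs p sp p0.
have [[x px]|noroot] := pselect (exists x, root p x); last first.
  exists [::], p; rewrite big_nil mul1r; split=> // x.
  by apply/negP => px; apply: noroot; exists x.
have /dvdpP[r pE] : 'X - x%:P %| p by rewrite dvdp_XsubCl.
have r0 : r != 0 by apply: contraNneq p0 => r0; rewrite pE r0 mul0r.
have [|ws [h [rE hx]]] := IHs (size r) _ r erefl r0.
  by rewrite -sp pE size_Mmonic ?monicXsubC // size_XsubC addn2.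
exists (x :: ws), h; split=> //.
by rewrite pE rE big_cons mulrC mulrA.
Qed.

Lemma monic_noroot_gt0 h x :
  h \is monic -> (forall y, ~~ root h y) -> 0 < h.[x].
Proof.
move=> hm hx; have [|N hN] := @poly_pinfty_gt_lc _ h.
  by rewrite (monicP hm) ltr01.
rewrite ltNge; apply/negP => hx0.
have [||y _] := @poly_ivt R h x (Num.max x N).
- by rewrite le_max lexx.
- rewrite hx0 (le_trans _ (hN _ _)) ?le_max ?lexx ?orbT //.
  by rewrite (monicP hm) ler01.
by rewrite (negPf (hx y)).
Qed.

Lemma horner_prod_sign ws x : x \notin ws ->
  0 < (-1) ^+ count (> x)%O ws * (\prod_(w <- ws) ('X - w%:P)).[x].
Proof.
elim: ws => [_|w ws IHws]; first by rewrite big_nil hornerC mulr1.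
rewrite inE negb_or big_cons hornerM hornerXsubC /= => /andP[neq /IHws].
case: (ltgtP x w) neq => // [ltxw|ltwx] _ pos.
  rewrite exprS mulN1r mulNr -mulrN -mulNr opprB mulrCA.
  by rewrite mulr_gt0 // subr_gt0.
by rewrite mulrCA mulr_gt0 // subr_gt0.
Qed.

Lemma coef_prod_sign ls j : (forall l, l \in ls -> 0 < l) ->
  0 <= (-1) ^+ (size ls + j) * (\prod_(l <- ls) ('X - l%:P))`_j.
Proof.
elim: ls j => [|l ls IHls] j pos.
  by rewrite big_nil coef1; case: j => [|j]; rewrite ?mulr0 ?mulr1.
have {}IHls i := IHls i (fun w wls => pos w (@mem_behead _ (l :: ls) w wls)).
rewrite big_cons mulrBl coefB coefXM coefCM /= addSn exprS mulN1r mulNr.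
rewrite -mulrN opprB.
rewrite mulrBr mulrCA addr_ge0 //.
  by rewrite mulr_ge0 // ltW // pos ?mem_head.
case: j => [|j] /=; first by rewrite mulr0 oppr0.
by rewrite addnS exprS mulN1r mulNr opprK.
Qed.

End Signs.

(** * Realizability and signs *)

Section Realizability.
Variable R : realType.
Implicit Types (x y l w : R) (ls ws : seq R).

Let prodX ws : {poly R} := \prod_(w <- ws) ('X - w%:P).

(** By Viete's formulas the coefficient of X^(n-1-k) in the product of the
    X - lam_i is (-1)^k sigma_k, and the inverse operator divides it by
    k + 1. *)
Lemma fpoly_star_inv n (lam : nat -> R) x : (0 < n)%N ->
  (fpoly n lam).[- x] =
    (-1) ^+ n.-1 *
    (star_inv n (prodX [seq lam i | i <- index_iota 2 n.+1])).[x].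
Proof.
case: n => // m _ /=; pose cs := [tuple lam (i + 2)%N | i < m].
have csE : [seq lam i | i <- index_iota 2 m.+2] = cs :> seq R.
  have sizeE : size (index_iota 2 m.+2) = m by rewrite size_iota subSS subn1.
  apply: (@eq_from_nth _ 0) => [|i];
    rewrite size_map sizeE ?size_tuple // => im.
  rewrite (nth_map 0%N) ?sizeE // nth_iota; last by rewrite subn2.
  by have := tnth_nth 0 cs (Ordinal im); rewrite tnth_mktuple addn2 => <-.
rewrite csE horner_poly horner_sum mulr_sumr (reindex_inj rev_ord_inj) /=.
apply: eq_bigr => k _; rewrite !hornerE subSS /=.
have km : (k <= m)%N by rewrite -ltnS.
rewrite subKn // subSn //.
have -> : sigma m.+1 lam (m - k) =
    mpoly.meval (tnth cs) (mpoly.mesym m R (m - k)).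
  by apply: mpoly.meval_eq => i; rewrite tnth_mktuple.
have := mpoly.mroots_coeff cs (rev_ord k); rewrite /= subSS subKn // => gk.
have signE : (-1) ^+ m = (-1) ^+ k * (-1) ^+ (m - k) :> R.
  by rewrite -exprD subnKC.
have -> : (prodX cs)`_k =
    (-1) ^+ (m - k) * mpoly.meval (tnth cs) (mpoly.mesym m R (m - k)) by [].
have sq1 : (-1) ^+ (m - k) * (-1) ^+ (m - k) = 1 :> R.
  by rewrite -expr2 sqrr_sign.
rewrite [(- x) ^+ k]exprNn signE -[LHS]mulr1 -[X in _ * X = _]sq1.
move: (mpoly.meval _ _) (_^-1) => c d; ring.
Qed.

(** Off the roots of q, at x = lam_(i+2), interlacing bounds the number of
    weights above x by the number of eigenvalues above x, hence by m - i - 1,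
    and the number of weights below x by i + 1.  As the weights are m in number,
    both bounds are attained, and the first one gives the sign of q(x). *)
Lemma interlacing_signs m ws ls i : size ws = m -> size ls = m ->
    (forall w, w \in ws -> 0 < w) -> sorted <=%O ls ->
    star_op m.+1 (prodX ws) = prodX ls -> (i.+1 < m)%N ->
  (-1) ^+ (m + i) * (prodX ws).[ls`_i] <= 0.
Proof.
move=> sws sls ws0 sortls gE im; set x := ls`_i.
have [xws|xws] := boolP (x \in ws).
  by rewrite (rootP _) ?mulr0 // root_prod_XsubC.
have q0 : prodX ws != 0 by rewrite monic_neq0 ?monic_prod_XsubC.
have sq : (size (prodX ws) <= m.+1)%N by rewrite size_prod_XsubC sws.
have memq y : root (prodX ws) y = (y \in ws) by rewrite root_prod_XsubC.
have memg y : root (star_op m.+1 (prodX ws)) y = (y \in ls).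
  by rewrite gE root_prod_XsubC.
have mult w : w \in ws -> (count_mem w ws <= (count_mem w ls).+1)%N.
  move=> wws; rewrite -!mu_prod_XsubC -/(prodX _) -/(prodX _) -gE.
  by rewrite -(@mup_star_op _ m.+1) ?memq // gt_eqF // ws0.
have sep v w : v \in ws -> w \in ws -> v < w -> exists2 z, z \in ls & v < z < w.
  move=> vws wws ltvw; have [||||z] := @star_op_rolle R m.+1 (prodX ws) v w;
    rewrite ?memq ?ws0 //; first by right.
  rewrite memg => zls [ltvz [w0|ltzw]]; last by exists z; rewrite ?ltvz.
  by have := ws0 w wws; rewrite w0 ltxx.
have above w : w \in ws -> exists2 z, z \in ls & w < z.
  move=> wws; have [||||z] := @star_op_rolle R m.+1 (prodX ws) w 0;
    rewrite ?memq ?ws0 //; first by left.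
  by rewrite memg => zls [ltwz _]; exists z.
have below_le : (count (< x) ws <= (count (< x) ls).+1)%N.
  have := @size_le_of_separated _ _ [seq w <- ws | w < x]
    [seq w <- ls | w < x] false.
  rewrite addn0 !size_filter; apply=> // [v w|w].
    rewrite !mem_filter => /andP[ltvx vws] /andP[ltwx wws] ltvw.
    have [z zls /andP[ltvz ltzw]] := sep v w vws wws ltvw.
    by exists z; rewrite ?mem_filter ?zls ?ltvz ?ltzw // (lt_trans ltzw).
  rewrite mem_filter => /andP[ltwx wws].
  have cf s : count_mem w [seq w <- s | w < x] = count_mem w s.
    rewrite count_filter; apply: eq_count => z /=.
    by case: eqVneq => // ->; rewrite ltwx.
  by rewrite !cf mult.
have above_le : (count (> x) ws <= count (> x) ls)%N.
  have := @size_le_of_separated _ _ [seq w <- ws | w > x]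
    [seq w <- ls | w > x] true.
  rewrite addn1 ltnS !size_filter; apply=> // [v w|w|_ w].
  - rewrite !mem_filter => /andP[ltxv vws] /andP[ltxw wws] ltvw.
    have [z zls /andP[ltvz ltzw]] := sep v w vws wws ltvw.
    by exists z; rewrite ?mem_filter ?zls ?ltvz ?ltzw // (lt_trans ltxv).
  - rewrite mem_filter => /andP[ltxw wws].
    have cf s : count_mem w [seq w <- s | w > x] = count_mem w s.
      rewrite count_filter; apply: eq_count => z /=.
      by case: eqVneq => // ->; rewrite ltxw.
    by rewrite !cf mult.
  - rewrite mem_filter => /andP[ltxw /above[z zls ltwz]].
    by exists z; rewrite // mem_filter zls (lt_trans ltxw).
have ws_split : (count (< x) ws + count (> x) ws = m)%N.
  rewrite -sws -(count_predC (< x)); congr addn; apply: eq_in_count => z zws /=.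
  by case: ltgtP => // zx; rewrite zx zws in xws.
have ls_below : (count (< x) ls <= i)%N.
  rewrite -[ls](cat_take_drop i) count_cat.
  rewrite [X in (_ + X)%N](_ : _ = 0)%N ?addn0.
    by rewrite (leq_trans (count_size _ _)) // size_take; case: ifP; lia.
  apply/eqP; rewrite -leqn0 leqNgt -has_count -all_predC.
  apply/(all_nthP 0) => j; rewrite size_drop sls nth_drop => jlt /=.
  rewrite -leNgt; apply: (sorted_leq_nth le_trans lexx) => //;
    rewrite ?inE ?sls ?leq_addr //; lia.
have ls_above : (count (> x) ls <= m - i.+1)%N.
  rewrite -[ls](cat_take_drop i.+1) count_cat.
  rewrite [X in (X + _)%N](_ : _ = 0)%N ?add0n.
    by rewrite (leq_trans (count_size _ _)) // size_drop sls.
  apply/eqP; rewrite -leqn0 leqNgt -has_count -all_predC.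
  apply/(all_nthP 0) => j; rewrite size_take sls => jlt /=.
  have ji : (j < i.+1)%N by move: jlt; case: ifP; lia.
  rewrite nth_take // -leNgt; apply: (sorted_leq_nth le_trans lexx) => //;
    rewrite ?inE ?sls; lia.
have cntE : count (> x) ws = (m - i.+1)%N by lia.
have := horner_prod_sign xws; rewrite cntE -/(prodX ws).
have -> : (-1) ^+ (m - i.+1) = - (-1) ^+ (m + i) :> R.
  rewrite (_ : m + i = m - i.+1 + i.*2.+1)%N; last by lia.
  by rewrite exprD exprS -mul2n exprM sqrrN !expr1n mulr1 mulrN1 opprK.
by rewrite mulNr oppr_gt0 => /ltW.
Qed.

(** The points at which parities are collected are 0 and all eigenvalues but
    the largest: m points in all, which is the number of roots to be found. *)
Lemma positive_roots_of_signs m ls : size ls = m -> (0 < m)%N ->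
    (forall l, l \in ls -> 0 < l) -> sorted <=%O ls ->
    (forall i, (i.+1 < m)%N ->
       (-1) ^+ (m + i) * (star_inv m.+1 (prodX ls)).[ls`_i] <= 0) ->
  exists ws, [/\ size ws = m, forall w, w \in ws -> 0 < w &
                 star_inv m.+1 (prodX ls) = prodX ws].
Proof.
move=> sls m0 ls0 sortls signs.
set g := prodX ls in signs *; set q := star_inv _ g in signs *.
have sg : size g = m.+1 by rewrite size_prod_XsubC sls.
have gq : star_op m.+1 q = g by rewrite star_op_inv ?sg.
have g0 : g != 0 by rewrite monic_neq0 ?monic_prod_XsubC.
have q0 : q != 0.
  apply: contraNneq g0 => q0.
  by rewrite -gq q0 /star_op deriv0 mulr0 mul0rn subr0.
have sq : (size q <= m.+1)%N by apply: size_poly.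
have qm : q`_m = 1.
  rewrite coef_poly ltnSn subSnn divr1.
  have /monicP := monic_prod_XsubC ls xpredT id.
  by rewrite lead_coefE -/(prodX _) -/g sg.
have {}sq : size q = m.+1.
  apply/eqP; rewrite eqn_leq sq /= ltnNge.
  apply/negP => /leq_sizeP/(_ m (leqnn _)).
  by rewrite qm => /eqP; rewrite oner_eq0.
have qmonic : q \is monic by rewrite monicE lead_coefE sq qm.
(* All terms of q(-y) have the sign (-1)^m, and the constant one is nonzero. *)
have q_neg y : 0 <= y -> 0 < (-1) ^+ m * q.[- y].
  move=> y0; rewrite horner_poly mulr_sumr.
  have term j : (j < m.+1)%N ->
      (-1) ^+ m * (g`_j / (m.+1 - j)%:R * (- y) ^+ j) =
      ((-1) ^+ (size ls + j) * g`_j) * (y ^+ j / (m.+1 - j)%:R).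
    by move=> _; rewrite [(- y) ^+ j]exprNn sls exprD; move: (_^-1) => c; ring.
  rewrite big_ord_recl /= ltr_pwDl //; last first.
    apply: sumr_ge0 => j _; rewrite term; last exact: ltn_ord (lift ord0 j).
    by rewrite mulr_ge0 ?coef_prod_sign // divr_ge0 ?exprn_ge0.
  rewrite term // mulr_gt0 //; last by rewrite expr0 divr_gt0 ?ltr0n.
  rewrite lt_neqAle coef_prod_sign // andbT eq_sym mulf_neq0 ?signr_eq0 //.
  rewrite -horner_coef0 -rootE root_prod_XsubC.
  by apply/negP => /ls0; rewrite ltxx.
have [ws [h [qE hx]]] := split_real_roots q0.
have pw0 : prodX ws != 0 by rewrite monic_neq0 ?monic_prod_XsubC.
have memq w : root q w = (w \in ws).
  by rewrite qE rootM root_prod_XsubC (negPf (hx w)) orbF.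
have ws0 w : w \in ws -> 0 < w.
  rewrite -memq ltNge => /rootP qw; apply/negP => w0.
  by have := q_neg (- w); rewrite opprK qw mulr0 ltxx oppr_ge0 => /(_ w0).
have hmonic : h \is monic.
  by rewrite -(monicMl _ (monic_prod_XsubC ws xpredT id)) -qE.
have h0 : h != 0 by rewrite monic_neq0.
have mult y : y \in ws -> (count_mem y ls <= count_mem y ws)%N.
  move=> yws; have y0 : y != 0 by rewrite gt_eqF ?ws0.
  rewrite -!mu_prod_XsubC -(@mupMl _ y (prodX ws) h) // -qE -/(prodX ls) -/g -gq.
  by rewrite (@mup_star_op _ m.+1 q) // memq.
(* As h is positive, q has the sign of the product over its real roots. *)
have parity x k : x \notin ws -> (-1) ^+ k * q.[x] <= 0 ->
    odd (count (> x) ws) = ~~ odd k.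
  move=> xws.
  have := mulr_gt0 (horner_prod_sign xws) (monic_noroot_gt0 x hmonic hx).
  rewrite -mulrA -hornerM -qE -signr_odd -[(-1) ^+ k]signr_odd.
  by do 2!case: odd; rewrite // => /lt_geF->.
have above0 : (m <= count (> 0%R) ws)%N.
  have n0ws : 0 \notin ws by apply/negP => /ws0; rewrite ltxx.
  have := @size_le_count_of_parity _ R ws (take m.-1 ls) 0.
  rewrite (negPf n0ws) addn0 /= size_takel ?sls ?leq_pred // prednK //; apply.
  - rewrite path_min_sorted ?take_sorted //.
    by apply/allP => l /mem_take/ls0/ltW.
  - case=> [|i] /= im; last first.
      rewrite nth_take // => xws; rewrite (parity _ (m + i)%N) //; last first.
        by apply: signs; move: im m0; clear; lia.
      rewrite (_ : m.-1 - i.+1 = m - i.+2)%N; last by move: im m0; clear; lia.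
      rewrite (_ : m + i = m - i.+2 + i.+1.*2)%N; last by move: im m0; clear; lia.
      by rewrite oddD odd_double addbF.
    move=> _; rewrite (parity _ m.+1) ?subn0 ?prednK //.
      by rewrite -{1}(prednK m0) /= negbK.
    by have /ltW := q_neg 0 (lexx 0); rewrite oppr0 exprS mulN1r mulNr oppr_le0.
  - move=> y yws; rewrite (lt_eqF (ws0 y yws)) add0n.
    apply: leq_trans (mult y yws).
    by rewrite -[in leqRHS](cat_take_drop m.-1 ls) count_cat leq_addr.
have sE : (size ws).+1 + size h = m.+2.
  by rewrite -sq qE size_mul // size_prod_XsubC prednK ?addSn // size_poly_gt0.
have {above0} := leq_trans above0 (count_size _ _) => lem.
have sh : (0 < size h)%N by rewrite size_poly_gt0.
have [sws sh1] : size ws = m /\ (size h <= 1)%N.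
  by move: sE lem sh; move: (size ws) (size h); clear=> a b; lia.
exists ws; split=> //.
rewrite qE; have -> : h = 1; last by rewrite mulr1.
have /size1_polyC hE := sh1.
by move/monicP: hmonic; rewrite hE lead_coefC => ->.
Qed.

End Realizability.

Theorem theorem2p6 (R : realType) (n : nat) (lam : nat -> R)
    (hn : (2 <= n)%N)
    (lam_gt0 : 0 < lam 2%N)
    (lam_le : forall i j : nat, (2 <= i)%N -> (i <= j)%N -> (j <= n)%N ->
       lam i <= lam j) :
  laplacian_realizable (star n) (0 :: [seq lam i | i <- index_iota 2 n.+1])
  <->
  (forall k : nat, (2 <= k)%N -> (k <= n.-1)%N ->
     (-1) ^+ k * (fpoly n lam).[- lam k] <= 0).
Proof.
case: n hn lam_le => [|m] //; rewrite ltnS => m0 lam_le.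
set ls := [seq lam i | i <- index_iota 2 m.+2].
have sls : size ls = m by rewrite size_map size_iota; lia.
have lsE i : (i < m)%N -> ls`_i = lam i.+2.
  by move=> im; rewrite (nth_map 0%N) ?size_iota ?nth_iota //; lia.
have sortls : sorted <=%O ls.
  apply/(sortedP 0) => i; rewrite sls => im.
  by rewrite !lsE ?lam_le //; lia.
have ls0 l : l \in ls -> 0 < l.
  move=> /mapP[i]; rewrite mem_index_iota => /andP[i2 im] ->.
  by apply: (lt_le_trans lam_gt0); apply: lam_le.
pose g : {poly R} := \prod_(l <- ls) ('X - l%:P).
have signE k : (-1) ^+ k.+2 * (fpoly m.+1 lam).[- lam k.+2] =
    (-1) ^+ (m + k) * (star_inv m.+1 g).[lam k.+2].
  by rewrite fpoly_star_inv //= !exprS !mulN1r opprK mulrA -exprD addnC.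
split=> [[A [SLA specA]]|signs].
  have gE : star_op m.+1 (\prod_(w <- star_weights A) ('X - w%:P)) = g.
    apply: (@mulfI _ 'X); first by rewrite polyX_eq0.
    by rewrite -char_poly_star // specA big_cons polyC0 subr0.
  have sw : size (star_weights A) = m by rewrite size_map size_enum_ord.
  case=> [|[|k]] // _ km; rewrite signE -gE star_inv_op; last first.
    by rewrite size_prod_XsubC sw.
  rewrite -lsE; last by lia.
  apply: interlacing_signs gE _ => //.
  by move=> w; apply: star_weights_gt0.
have [|ws [sws ws0 qE]] := positive_roots_of_signs sls m0 ls0 sortls.
  by move=> i im; rewrite lsE -?signE; [apply: signs|]; lia.
have [A SLA wA] := star_matrix_exists sws ws0.
exists A; split=> //; rewrite /has_spectrum char_poly_star // wA -qE.
rewrite star_op_inv; last by rewrite size_prod_XsubC sls.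
by rewrite big_cons polyC0 subr0.
Qed.
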